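(* Let $m\ge1$ and $k\ge1$ be integers. Then \[ \sum_{n\ge0}\Big(\sum_{\lambda\vdash n}\#\{i:\ \lambda_i\ge m,\ h_{i,m}(\lambda)=k\}\Big)q^n=\frac{q^{km}}{(q^k;q)_\infty}\sum_{l=1}^{k}\frac{q^{-(l-1)(m-1)}(q^m;q)_{l-1}}{(q;q)_{l-1}(q;q)_{k-l}}, \] i.e. the right-hand side is the generating function for the number of $m$th column hooks of size $k$ in all partitions of $n$.
   Context: For a partition $\lambda=(\lambda_1\ge\lambda_2\ge\cdots)$ with conjugate $\lambda'$, the hook length of the cell $(i,j)$ (with $j\le\lambda_i$) is $h_{i,j}(\lambda)=\lambda_i+\lambda'_j-i-j+1$. Notation: $(a;b)_n=\prod_{t=0}^{n-1}(1-ab^t)$ and $(a;b)_\infty=\prod_{t=0}^{\infty}(1-ab^t)$. *)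

(* Defs.v *)
From HB Require Import structures.
From mathcomp Require Import all_boot all_order all_algebra.
From mathcomp Require Import complex.
From mathcomp Require Import all_classical all_reals all_analysis.

Set Implicit Arguments.
Unset Strict Implicit.
Unset Printing Implicit Defensive.

Import Order.TTheory GRing.Theory Num.Theory.
Import numFieldNormedType.Exports.

Local Open Scope nat_scope.

Definition is_part (s : seq nat) : bool := sorted geq s && (0 \notin s).

Record intpart (n : nat) : Type := IntPart {
  parts :> seq nat;
  intpartP : is_part parts && (sumn parts == n)
}.

HB.instance Definition _ n := [isSub for @parts n].
HB.instance Definition _ n := [Countable of intpart n by <:].

Section IntpartFinite.

Lemma filter_mkseq_nth (s : seq nat) (n : nat) :
  0 \notin s -> size s <= n -> [seq x <- mkseq (nth 0 s) n | 0 < x] = s.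
Proof.
elim: s n => [|x s IHs] n.
  move=> _ _; rewrite (eq_in_filter (a2 := pred0)) ?filter_pred0 // => y.
  by case/mapP=> i _ ->; rewrite nth_nil.
rewrite inE negb_or eq_sym -lt0n => /andP[x0 s0]; case: n => // n /= lesn.
rewrite x0; congr (_ :: _); rewrite -[RHS](IHs n s0 lesn) /mkseq.
by rewrite -[1]addn0 iotaDl -map_comp; congr seq.filter; apply: eq_map.
Qed.

Lemma size_le_sumn (s : seq nat) : 0 \notin s -> size s <= sumn s.
Proof.
elim: s => //= x s IHs; rewrite inE negb_or eq_sym -lt0n => /andP[x0 /IHs].
by move=> le_s; rewrite -add1n leq_add.
Qed.

Lemma nth_le_sumn (s : seq nat) (i : nat) : nth 0 s i <= sumn s.
Proof.
elim: s i => [|x s IHs] [|i] //=; first exact: leq_addr.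
exact: leq_trans (IHs i) (leq_addl _ _).
Qed.

Variable n : nat.

Definition intpart_code (la : intpart n) : {ffun 'I_n -> 'I_n.+1} :=
  [ffun i : 'I_n => inord (nth 0 la i)].

Definition intpart_decode (f : {ffun 'I_n -> 'I_n.+1}) : option (intpart n) :=
  insub [seq x <- [seq val (f i) | i <- enum 'I_n] | 0 < x].

Lemma intpart_codeK : pcancel intpart_code intpart_decode.
Proof.
case=> s sP; rewrite /intpart_decode.
have /andP[/andP[_ s0] /eqP sn] := sP.
have -> : [seq x <- [seq val (intpart_code (IntPart sP) i) | i <- enum 'I_n]
            | 0 < x] = s.
  rewrite -[RHS](@filter_mkseq_nth s n) //; last by rewrite -sn size_le_sumn.
  congr seq.filter; rewrite /mkseq -val_enum_ord -map_comp.
  apply: eq_map => i /=; rewrite ffunE /= inordK // ltnS.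
  by apply: leq_trans (nth_le_sumn s i) _; rewrite sn.
exact: (valK (IntPart sP)).
Qed.

End IntpartFinite.

HB.instance Definition _ n :=
  fintype.isFinite.Build (intpart n) (pcan_enumP (@intpart_codeK n)).

(* Rows and columns are numbered from 1; parts beyond the length are 0. *)
Definition part (la : seq nat) (i : nat) : nat := nth 0 la i.-1.

(* The conjugate partition at j >= 1: the number of rows of length >= j. *)
Definition conj_part (la : seq nat) (j : nat) : nat :=
  count (fun p => j <= p) la.

(* The subtractions do not truncate when (i, j) is a cell of la, since then
   j <= part la i and i <= conj_part la j. *)
Definition hook_length (la : seq nat) (i j : nat) : nat :=
  part la i + conj_part la j - i - j + 1.

(* Rows i > size la need not be inspected: there part la i = 0 < m. *)
Definition nb_col_hooks (m k : nat) (la : seq nat) : nat :=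
  count (fun i => (m <= part la i) && (hook_length la i m == k))
    (iota 1 (size la)).

Local Open Scope classical_set_scope.
Local Open Scope ring_scope.

Definition qpoch (K : pzRingType) (a b : K) (n : nat) : K :=
  \prod_(0 <= t < n) (1 - a * b ^+ t).

(* R[i]^o is R[i] with the topology of its modulus. *)
Definition qpoch_inf (R : realType) (a b : R[i]^o) : R[i]^o :=
  lim (qpoch a b @ \oo).

(* Main.v *)
(* Count only the partitions whose parts are at most N, and remove a part equal
   to N+1 when there is one: this expresses every generating function at N+1
   through the one at N. For the number of hooks of size k in column m, the
   removed first row of length m + a contributes when exactly b = k - 1 - a of
   the remaining parts are >= m; those partitions have generating function
   q^(bm) / (q;q)_(m-1) times the q-binomial of (a + b, b), by the q-Pascal rule.
   Hence the generating function at N times (q;q)_N is constant for N >= m+k-1,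
   equal to the sum over a of the paper (with l = a + 1).  A bound on the
   partial sums at |q|, uniform in N, allows N to tend to infinity. *)
Require Import Defs.
From HB Require Import structures.
From mathcomp Require Import all_boot all_order all_algebra.
From mathcomp Require Import complex.
From mathcomp Require Import all_classical all_reals all_analysis.
From mathcomp Require Import zify ring lra.

Set Implicit Arguments.
Unset Strict Implicit.
Unset Printing Implicit Defensive.

Import Order.TTheory GRing.Theory Num.Theory.
Import numFieldNormedType.Exports.
Local Open Scope classical_set_scope.
Local Open Scope ring_scope.

(** * Partitions with bounded parts *)

Section BoundedParts.
Local Open Scope nat_scope.

(** The parts are sorted, so bounding the head bounds them all; the default 0 admits the empty
    partition for every [N]. *)
Definition bounded_parts (N n : nat) : seq (seq nat) :=
  [seq val la | la <- enum {: intpart n} & head 0 (val la) <= N].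

Lemma mem_bounded_parts N n s :
  (s \in bounded_parts N n) = [&& is_part s, sumn s == n & head 0 s <= N].
Proof.
apply/mapP/idP => [[la]|/and3P[s_part sn sN]].
  by rewrite mem_filter mem_enum => /andP[laN _] ->; rewrite andbA (valP la).
have sP : is_part s && (sumn s == n) by rewrite s_part.
by exists (IntPart sP) => //; rewrite mem_filter mem_enum sN.
Qed.

Lemma bounded_parts_uniq N n : uniq (bounded_parts N n).
Proof.
rewrite map_inj_uniq; last by move=> a b /val_inj.
exact/filter_uniq/enum_uniq.
Qed.

Lemma is_part_cons x s :
  is_part (x :: s) = [&& 0 < x, head 0 s <= x & is_part s].
Proof.
rewrite /is_part inE negb_or eq_sym -lt0n.
by case: s => [|y s] /=; rewrite /geq /=; case: (0 < x); case: (_ <= x);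
  rewrite ?andbF.
Qed.

Lemma part_le_head s y : is_part s -> y \in s -> y <= head 0 s.
Proof.
have geq_trans : transitive geq by move=> b a c ab bc; exact: leq_trans bc ab.
case: s => // x s /andP[/(order_path_min geq_trans)/allP xs _].
by rewrite inE => /predU1P[->//|/xs].
Qed.

(** Split by whether the largest part is [N.+1]. Only one copy of it is removed, so the rest may
    still contain [N.+1]; the test [N.+1 <= n] keeps the subtraction exact. *)
Lemma perm_bounded_partsS N n :
  perm_eq (bounded_parts N.+1 n)
    (bounded_parts N n ++ if N.+1 <= n
      then map (cons N.+1) (bounded_parts N.+1 (n - N.+1)) else [::]).
Proof.
apply: uniq_perm; first exact: bounded_parts_uniq.
  rewrite cat_uniq bounded_parts_uniq /=; case: ifP => //= _.
  rewrite map_inj_uniq ?bounded_parts_uniq ?andbT; last by move=> ? ? [].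
  apply/hasPn => _ /mapP[s _ ->].
  by rewrite mem_bounded_parts /= ltnn !andbF.
move=> s; rewrite mem_cat !mem_bounded_parts.
have [sN|sN] := leqP (head 0 s) N.
  rewrite (leqW sN) orbC; case: ifP => // _; case: mapP => [[t _ st]|//].
  by rewrite st /= ltnn in sN.
rewrite !andbF /=; case: s sN => [|x s] //= xN; case: ifP => Nn.
  apply/and3P/mapP => [[xs_part xsn xN']|[t]].
    have -> : x = N.+1 by lia.
    exists s => //; move: xs_part; rewrite is_part_cons mem_bounded_parts.
    by case/and3P => _ sx ->; lia.
  rewrite mem_bounded_parts => /and3P[tP tn tN] [-> ->].
  by rewrite is_part_cons tN tP /=; split=> //; lia.
by apply/negbTE/and3P => -[_ xsn xN']; lia.
Qed.

(* Weighted count of the partitions of n with no part larger than N. *)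
Definition psum (w : seq nat -> nat) (N n : nat) : nat :=
  \sum_(s <- bounded_parts N n) w s.

Lemma psumS w N n :
  psum w N.+1 n = psum w N n +
    if N.+1 <= n then psum (w \o cons N.+1) N.+1 (n - N.+1) else 0.
Proof.
rewrite /psum (perm_big _ (perm_bounded_partsS N n)) big_cat /=.
by case: ifP => _; rewrite ?big_map ?big_nil.
Qed.

Lemma eq_psum w v N n :
  (forall s, is_part s -> head 0 s <= N -> w s = v s) ->
  psum w N n = psum v N n.
Proof.
move=> wv; apply: eq_big_seq => s.
by rewrite mem_bounded_parts => /and3P[sP _ sN]; apply: wv.
Qed.

Lemma psumD w v N n :
  psum (fun s => w s + v s) N n = psum w N n + psum v N n.
Proof. exact: big_split. Qed.

Lemma psum_const0 N n : psum (fun=> 0) N n = 0.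
Proof. by rewrite /psum big1. Qed.

Lemma psum0 w n : psum w 0 n = (n == 0) * w [::].
Proof.
have eqb : perm_eq (bounded_parts 0 n) (if n == 0 then [:: [::]] else [::]).
  apply: uniq_perm; rewrite ?bounded_parts_uniq //; first by case: ifP.
  move=> s; rewrite mem_bounded_parts; case: s => [|x s].
    by rewrite [0 == n]eq_sym; case: ifP.
  rewrite is_part_cons lt0n leqn0 [head _ (x :: s)]/=.
  by case: (x == 0) => /=; rewrite ?andbF; case: ifP.
rewrite /psum (perm_big _ eqb); case: ifP => _.
  by rewrite big_seq1 mul1n.
by rewrite big_nil.
Qed.

Lemma head_le_sumn (s : seq nat) : head 0 s <= sumn s.
Proof. by case: s => //= x s; exact: leq_addr. Qed.

Lemma psum_le_sum w N n : psum w N n <= \sum_(la : intpart n) w la.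
Proof.
rewrite /psum big_map big_filter big_enum_cond.
by rewrite [leqRHS](bigID (fun la : intpart n => head 0 (val la) <= N)) leq_addr.
Qed.

Lemma psum_all w N n : n <= N -> psum w N n = \sum_(la : intpart n) w la.
Proof.
move=> nN; rewrite /psum big_map big_filter big_enum_cond; apply: eq_bigl => la.
have /andP[_ /eqP lan] := valP la.
by apply: leq_trans (head_le_sumn _) _; rewrite lan.
Qed.

(** A new first row leaves the old hooks unchanged: if an old row reaches column [m], so does the
    longer first row, hence the row index and the height of column [m] both grow by one and
    cancel. *)
Lemma nb_col_hooks_cons m k x s : is_part (x :: s) ->
  nb_col_hooks m k (x :: s) =
    nb_col_hooks m k s + ((m <= x) && (x - m + count (leq m) s + 1 == k)).
Proof.
move=> xs_part; rewrite /nb_col_hooks /= addnC; congr (_ + _).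
  rewrite (iotaDl 1 1) count_map; apply: eq_in_count => i.
  rewrite mem_iota => /andP[i_gt0 i_le]; case: i i_gt0 i_le => // i _ i_le /=.
  rewrite /part /=; case: leqP => //= m_le.
  have mx : m <= x.
    apply: leq_trans m_le (part_le_head xs_part _).
    by rewrite inE mem_nth ?orbT //; exact: i_le.
  by rewrite /hook_length /part /conj_part /= mx; congr (_ == _); lia.
rewrite /hook_length /part /conj_part /=; case: leqP => //= mx.
change (fun p => m <= p) with (leq m).
by congr (nat_of_bool (_ == _)); lia.
Qed.

(* Putting a first row of length x >= m on top of s creates the hook
   (x - m) + count (leq m) s + 1 in column m. *)
Definition leg_weight (m b : nat) (s : seq nat) : nat :=
  count (leq m) s == b.

Lemma nb_col_hooks_consE m k x s : is_part (x :: s) ->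
  nb_col_hooks m k.+1 (x :: s) = nb_col_hooks m k.+1 s +
    if (m <= x) && (x - m <= k) then leg_weight m (k - (x - m)) s else 0.
Proof.
move=> /nb_col_hooks_cons ->; congr (_ + _); rewrite /leg_weight.
case: (m <= x) => //=; case: leqP => xm; last by case: eqP => //; lia.
by congr nat_of_bool; apply/eqP/eqP; lia.
Qed.

End BoundedParts.

(** * Truncated generating functions for bounded parts *)

Section PartialSums.
Variables (K : comNzRingType) (x : K).

(** The ring is arbitrary so that the same recurrences serve the complex number q and its real
    modulus r. *)
Definition gf_partial (w : seq nat -> nat) (N M : nat) : K :=
  \sum_(0 <= n < M) (psum w N n)%:R * x ^+ n.

(** For [M <= N.+1] the truncated subtraction yields an empty sum, which is correct: no partition of
    a number below [M] has a part [N.+1]. *)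
Lemma gf_partialS w N M :
  gf_partial w N.+1 M = gf_partial w N M +
    x ^+ N.+1 * gf_partial (w \o cons N.+1) N.+1 (M - N.+1).
Proof.
rewrite /gf_partial.
under eq_bigr do rewrite psumS natrD mulrDl.
rewrite big_split /=; congr (_ + _).
have [MN|NM] := leqP M N.+1.
  rewrite (eqP MN) [X in _ = _ * X]big_geq // mulr0 big_nat big1 // => i iM.
  by rewrite leqNgt (leq_trans _ MN) ?mul0r//; case/andP: iM.
rewrite (big_cat_nat (n := N.+1)) //=; last exact: ltnW.
rewrite big_nat big1 ?add0r => [|i /andP[_ iN]]; last first.
  by rewrite leqNgt iN mul0r.
rewrite -[X in \sum_(X <= _ < _) _]add0n big_addn mulr_sumr.
apply: eq_bigr => i _; rewrite leq_addl addnK exprD; ring.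
Qed.

Lemma eq_gf_partial w v N M :
  (forall s, is_part s -> (head 0 s <= N)%N -> w s = v s) ->
  gf_partial w N M = gf_partial v N M.
Proof. by move=> wv; apply: eq_bigr => n _; rewrite (eq_psum n wv). Qed.

Lemma gf_partialD w v N M :
  gf_partial (fun s => w s + v s)%N N M = gf_partial w N M + gf_partial v N M.
Proof.
rewrite /gf_partial -big_split; apply: eq_bigr => n _ /=.
by rewrite psumD natrD mulrDl.
Qed.

Lemma gf_partial_const0 N M : gf_partial (fun=> 0)%N N M = 0.
Proof. by rewrite /gf_partial big1 // => n _; rewrite psum_const0 mul0r. Qed.

Lemma gf_partial0 w M : gf_partial w 0 M = (0 < M)%:R * (w [::])%:R.
Proof.
case: M => [|M]; first by rewrite /gf_partial big_geq // mul0r.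
rewrite /gf_partial big_nat_recl //= psum0 mul1n expr0 mulr1 big1 ?addr0 ?mul1r//.
by move=> i _; rewrite psum0 mul0r.
Qed.

End PartialSums.

(** * Recurrences in the largest part for legs and hooks *)

Section LegHookPartialSums.
Variables (K : comNzRingType) (x : K).

Lemma gf_leg0_small m N M : (N.+1 < m)%N ->
  gf_partial x (leg_weight m 0) N.+1 M = gf_partial x (leg_weight m 0) N M +
    x ^+ N.+1 * gf_partial x (leg_weight m 0) N.+1 (M - N.+1).
Proof.
move=> Nm; rewrite gf_partialS; congr (_ + _ * _); apply: eq_gf_partial => s _ _.
by rewrite /leg_weight /= leqNgt Nm.
Qed.

Lemma gf_legS_small m b N M : (N < m)%N ->
  gf_partial x (leg_weight m b.+1) N M = 0.
Proof.
move=> Nm; rewrite -(gf_partial_const0 x N M); apply: eq_gf_partial => s sP sN.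
rewrite /leg_weight (eqP (_ : count (leq m) s == 0)%N) //.
rewrite -leqn0 leqNgt -has_count; apply/hasPn => y ys; rewrite -ltnNge.
apply: leq_ltn_trans Nm; apply: leq_trans sN.
exact: part_le_head.
Qed.

Lemma gf_leg0_large m N M : (m <= N.+1)%N ->
  gf_partial x (leg_weight m 0) N.+1 M = gf_partial x (leg_weight m 0) N M.
Proof.
move=> mN; rewrite gf_partialS -[RHS]addr0; congr (_ + _).
rewrite -(mulr0 (x ^+ N.+1)) -(gf_partial_const0 x N.+1 (M - N.+1)).
congr (_ * _); apply: eq_gf_partial => s _ _.
by rewrite /leg_weight /= mN.
Qed.

(** The removed row is itself one of the [b.+1] rows of length at least [m], so [b] of them
    remain. *)
Lemma gf_legS_large m b N M : (m <= N.+1)%N ->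
  gf_partial x (leg_weight m b.+1) N.+1 M =
    gf_partial x (leg_weight m b.+1) N M +
    x ^+ N.+1 * gf_partial x (leg_weight m b) N.+1 (M - N.+1).
Proof.
move=> mN; rewrite gf_partialS; congr (_ + _ * _); apply: eq_gf_partial => s _ _.
by rewrite /leg_weight /= mN add1n eqSS.
Qed.

Lemma gf_hooks_cons m k N M :
  gf_partial x (nb_col_hooks m k.+1) N.+1 M =
    gf_partial x (nb_col_hooks m k.+1) N M +
    x ^+ N.+1 * (gf_partial x (nb_col_hooks m k.+1) N.+1 (M - N.+1) +
      if (m <= N.+1)%N && (N.+1 - m <= k)%N
      then gf_partial x (leg_weight m (k - (N.+1 - m))) N.+1 (M - N.+1) else 0).
Proof.
rewrite gf_partialS; congr (_ + _ * _).
transitivity (gf_partial x (fun s => nb_col_hooks m k.+1 s +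
  if (m <= N.+1) && (N.+1 - m <= k)
  then leg_weight m (k - (N.+1 - m)) s else 0)%N N.+1 (M - N.+1)).
  apply: eq_gf_partial => s sP sN /=.
  by rewrite nb_col_hooks_consE // is_part_cons sN sP.
rewrite gf_partialD; congr (_ + _); case: ifP => // _.
by rewrite gf_partial_const0.
Qed.

End LegHookPartialSums.

Lemma qpochD (K : pzRingType) (a q : K) m n :
  qpoch a q (m + n) = qpoch a q m * qpoch (a * q ^+ m) q n.
Proof.
rewrite /qpoch (big_cat_nat (n := m)) ?leq_addr //=; congr (_ * _).
rewrite -{1}[m]add0n big_addn addKn; apply: eq_bigr => i _.
by rewrite -mulrA -exprD [(m + i)%N]addnC.
Qed.

(** * Bounds at a real point of [0, 1) *)

Section RealBounds.
Variables (R : realType) (r : R).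
Hypotheses (r_ge0 : 0 <= r) (r_lt1 : r < 1).

Let expr_lt1 n : r ^+ n.+1 < 1.
Proof. by rewrite exprn_ilt1. Qed.

Definition gf_bounded w N := exists C, forall M, gf_partial r w N M <= C.

Lemma gf_partial_le w N M M' : (M <= M')%N ->
  gf_partial r w N M <= gf_partial r w N M'.
Proof.
move=> MM'; rewrite /gf_partial (big_cat_nat (n := M) (p := M')) //= lerDl.
by apply: sumr_ge0 => n _; rewrite mulr_ge0 ?exprn_ge0.
Qed.

Lemma gf_partial_ge0 w N M : 0 <= gf_partial r w N M.
Proof. by apply: sumr_ge0 => n _; rewrite mulr_ge0 ?exprn_ge0. Qed.

(** Partial sums increase with [M], so replacing [M - N.+1] by [M] gives G <= C + r^(N+1) (G + D),
    which is solved for G. *)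
Lemma gf_bounded_rec w v N :
  (forall M, gf_partial r w N.+1 M = gf_partial r w N M +
    r ^+ N.+1 * (gf_partial r w N.+1 (M - N.+1) + v (M - N.+1)%N)) ->
  gf_bounded w N -> (exists C, forall M, v M <= C) -> gf_bounded w N.+1.
Proof.
move=> wE [C wC] [D vD]; exists ((C + r ^+ N.+1 * D) / (1 - r ^+ N.+1)) => M.
have rN1 := expr_lt1 N; have rN0 : 0 <= r ^+ N.+1 by rewrite exprn_ge0.
rewrite ler_pdivlMr ?subr_gt0 // mulrBr mulr1 lerBlDr {1}wE mulrDr addrA.
rewrite addrAC; apply: lerD; first by apply: lerD => //; apply: ler_wpM2l.
by rewrite mulrC ler_wpM2r // gf_partial_le // leq_subr.
Qed.

Lemma gf_bounded_leg m b N : gf_bounded (leg_weight m b) N.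
Proof.
elim: b N => [|b IHb]; elim=> [|N [C IHN]].
- by exists 1 => M; rewrite gf_partial0 mulr1 lern1 leq_b1.
- have [mN|Nm] := leqP m N.+1.
    by exists C => M; rewrite gf_leg0_large.
  apply: (@gf_bounded_rec _ (fun=> 0)) => [M||].
  + by rewrite addr0 gf_leg0_small.
  + by exists C.
  + by exists 0.
- by exists 0 => M; rewrite gf_partial0 mulr0.
- have [mN|Nm] := leqP m N.+1.
    have [D IHD] := IHb N.+1; exists (C + r ^+ N.+1 * D) => M.
    by rewrite gf_legS_large // lerD // ler_wpM2l ?exprn_ge0.
  by exists 0 => M; rewrite gf_legS_small.
Qed.

Lemma gf_bounded_hooks m k N : gf_bounded (nb_col_hooks m k.+1) N.
Proof.
elim: N => [|N IHN]; first by exists 0 => M; rewrite gf_partial0 mulr0.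
apply: (@gf_bounded_rec _ (fun M => if (m <= N.+1)%N && (N.+1 - m <= k)%N
    then gf_partial r (leg_weight m (k - (N.+1 - m))) N.+1 M else 0)) => //.
  by move=> M; exact: gf_hooks_cons.
case: (_ && _); last by exists 0.
exact: gf_bounded_leg.
Qed.

Lemma qpoch_le1 (a : R) n : 0 <= a <= 1 -> 0 <= qpoch a r n <= 1.
Proof.
move=> /andP[a0 a1]; elim: n => [|n /andP[IH0 IH1]].
  by rewrite /qpoch big_geq // ler01 lexx.
have arn0 : 0 <= a * r ^+ n by rewrite mulr_ge0 ?exprn_ge0.
have arn1 : a * r ^+ n <= 1 by rewrite mulr_ile1 ?exprn_ge0 ?exprn_ile1 // ltW.
rewrite /qpoch big_nat_recr //= -/(qpoch a r n).
by rewrite mulr_ge0 ?subr_ge0 //= mulr_ile1 ?subr_ge0 // gerBl.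
Qed.

(** The Weierstrass product inequality: a product of factors 1 - u with u in [0, 1] is at least 1
    minus the sum of the u. *)
Lemma qpoch_ge (a : R) n : 0 <= a <= 1 ->
  1 - a * \sum_(0 <= t < n) r ^+ t <= qpoch a r n.
Proof.
move=> a01; elim: n => [|n IHn].
  by rewrite /qpoch !big_geq // mulr0 subr0.
have /andP[P0 P1] := qpoch_le1 n a01; case/andP: a01 => a0 _.
have arn0 : 0 <= a * r ^+ n by rewrite mulr_ge0 ?exprn_ge0.
rewrite /qpoch !big_nat_recr //= -/(qpoch a r n) mulrDr opprD addrA mulrBr mulr1.
by apply: lerB => //; rewrite ler_piMl.
Qed.

Lemma geom_sum_le n : \sum_(0 <= t < n) r ^+ t <= (1 - r)^-1.
Proof.
rewrite -[leRHS]mul1r ler_pdivlMr ?subr_gt0 // big_mkord.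
have -> : (\sum_(i < n) r ^+ i) * (1 - r) = 1 - r ^+ n.
  by have := subrX1 r n; lra.
by rewrite gerBl exprn_ge0.
Qed.

(** Cut the product at a [T] with r^T <= (1 - r) / 2: by [qpoch_ge] and the geometric sum, the
    factors beyond [T] multiply to at least 1/2. *)
Lemma qpoch_lower_bound : exists2 d, 0 < d & forall n, d <= qpoch r r n.
Proof.
have r1 : 0 < 1 - r by rewrite subr_gt0.
have [T rT] : exists T, r ^+ T <= (1 - r) / 2.
  have geo : (fun n => r ^+ n) @ \oo --> (0 : R).
    by apply: cvg_expr; rewrite ger0_norm.
  have eps_gt0 : 0 < (1 - r) / 2 by rewrite divr_gt0.
  move/cvgrPdist_lt: geo => /(_ _ eps_gt0)[T _ /(_ T (leqnn T))] /=.
  rewrite sub0r normrN ger0_norm ?exprn_ge0 // => /ltW; by exists T.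
have r01 : 0 <= r <= 1 by rewrite r_ge0 ltW.
have PT_gt0 n : 0 < qpoch r r n.
  by apply: prodr_gt0 => t _; rewrite subr_gt0 -exprS.
exists (qpoch r r T / 2) => [|n]; first by rewrite divr_gt0.
have PTn : qpoch r r T / 2 <= qpoch r r (T + n).
  rewrite qpochD //; apply: ler_wpM2l; first exact: ltW.
  have rT01 : 0 <= r * r ^+ T <= 1 by rewrite -exprS exprn_ge0 //= ltW.
  apply: le_trans (qpoch_ge n rT01).
  have : r * r ^+ T * \sum_(0 <= t < n) r ^+ t <= 1 * ((1 - r) / 2) * (1 - r)^-1.
    apply: ler_pM; rewrite ?geom_sum_le ?sumr_ge0 //.
    + by case/andP: rT01.
    + by move=> i _; rewrite exprn_ge0.
    + by apply: ler_pM; rewrite ?exprn_ge0 // ltW.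
  have -> : 1 * ((1 - r) / 2) * (1 - r)^-1 = 2^-1 by field; rewrite gt_eqF.
  lra.
(* Dropping the last [T] factors, whose product is at most 1, covers every [n], including those
   below [T]. *)
apply: (le_trans PTn); rewrite addnC qpochD //.
apply: ler_piMr; first exact: ltW.
have /(qpoch_le1 T)/andP[] // : 0 <= r * r ^+ n <= 1.
by rewrite -exprS exprn_ge0 //= ltW.
Qed.

(** From N = m + k on, the removed row is too long to create a hook of size [k.+1]. Hence S(N+1) (1
    - r^(N+1)) <= S(N), so S(N) (r;r)_N does not increase, and (r;r)_N stays above a positive
    constant. *)
Lemma gf_hooks_uniform_bound m k :
  exists C, forall N M, gf_partial r (nb_col_hooks m k.+1) N M <= C.
Proof.
have [d d0 dP] := qpoch_lower_bound.
have [C0 C0P] := gf_bounded_hooks m k (m + k).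
have P01 n : 0 <= qpoch r r n <= 1 by apply: qpoch_le1; rewrite r_ge0 ltW.
set S := gf_partial r _.
have decr j M : S (m + k + j)%N M * qpoch r r (m + k + j) <= C0.
  elim: j => [|j IHj].
    rewrite addn0 -[C0]mulr1; have /andP[P0 P1] := P01 (m + k)%N.
    by apply: ler_pM => //; exact: gf_partial_ge0.
  apply: le_trans IHj; rewrite addnS; set N := (m + k + j)%N.
  rewrite /qpoch big_nat_recr //= -/(qpoch r r N) -exprS mulrCA mulrC.
  have /andP[P0 P1] := P01 N.
  apply: ler_wpM2r => //; rewrite mulrBr mulr1 lerBlDr /S {1}gf_hooks_cons.
  rewrite [X in if X then _ else _](_ : _ = false) ?addr0; last first.
    by rewrite /N; lia.
  by rewrite lerD2l mulrC ler_wpM2r ?exprn_ge0 // gf_partial_le // leq_subr.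
exists (C0 / d) => N M; rewrite ler_pdivlMr //.
have SN : S N M <= S (m + k + N)%N M.
  have -> : (m + k + N = N + (m + k))%N by rewrite addnC.
  elim: (m + k)%N => [|j IHj]; first by rewrite addn0.
  rewrite addnS (le_trans IHj) // /S gf_partialS lerDl.
  by rewrite mulr_ge0 ?exprn_ge0 ?gf_partial_ge0.
apply: le_trans (decr N M); apply: ler_pM => //; first exact: gf_partial_ge0.
exact: ltW.
Qed.

End RealBounds.

(** * Convergence of complex sequences and series *)

Section ComplexSeries.
Variable R : realType.
Local Notation C := (R[i]^o).

Lemma norm_real_complex (x : R) : `|x%:C%C| = `|x|%:C%C.
Proof. by rewrite normc_def /= expr0n addr0 sqrtr_sqr. Qed.

Lemma cvg_real_complex (x : nat -> R) (l : R) :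
  x @ \oo --> l -> (fun n => (x n)%:C%C : C) @ \oo --> (l%:C%C : C).
Proof.
move=> /cvgrPdist_lt xl; apply/cvgrPdist_lt => e.
rewrite ltcE => /andP[/eqP e_im e_re]; near=> n.
rewrite -rmorphB norm_real_complex ltcE /= e_im eqxx /=.
near: n; exact: xl.
Unshelve. all: by end_near. Qed.

Lemma dominated_series_cvg (a : nat -> R) (b : nat -> R) (B : R) :
  (forall n, `|a n| <= b n) -> (forall n, series b n <= B) -> cvgn (series a).
Proof.
move=> ab bB; apply: (@normed_cvg R R^o).
have b_ge0 n : 0 <= b n by apply: le_trans (ab n).
apply: nondecreasing_is_cvgn.
  by apply/nondecreasing_seqP => n; rewrite /series /= [leRHS]big_nat_recr //= lerDl.
exists B => _ [n _ <-]; apply: le_trans (bB n).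
by apply: ler_sum => i _; exact: ab.
Qed.

Lemma dominated_complex_series_cvg (a : nat -> C) (b : nat -> R) (B : R) :
  (forall n, `|a n| <= (b n)%:C%C) -> (forall n, series b n <= B) ->
  exists l : C, series a @ \oo --> l.
Proof.
move=> ab bB.
have re_cvg : cvgn (series (fun n => complex.Re (a n))).
  apply: dominated_series_cvg bB => n; rewrite -lecR.
  exact: le_trans (normc_ge_Re _) (ab n).
have im_cvg : cvgn (series (fun n => complex.Im (a n))).
  apply: dominated_series_cvg bB => n; rewrite -lecR.
  apply: le_trans (ab n); rewrite -norm_real_complex.
  (* Multiplication by i preserves the modulus, so the bound on real parts also bounds imaginary
     parts. *)
  have -> : (complex.Im (a n))%:C%C = - (complex.Re (a n * 'i%C))%:C%C.
    by rewrite ReiNIm rmorphN opprK.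
  rewrite normrN norm_real_complex (le_trans (normc_ge_Re _)) // normrM.
  rewrite [X in _ * X](_ : _ = 1) ?mulr1 // normc_def /=.
  by rewrite expr0n expr1n add0r sqrtr1.
exists ((limn (series (fun n => complex.Re (a n))))%:C%C +
  'i%C * (limn (series (fun n => complex.Im (a n))))%:C%C).
have -> : series a = (fun n => (series (fun n => complex.Re (a n)) n)%:C%C +
    'i%C * (series (fun n => complex.Im (a n)) n)%:C%C).
  apply/funext => n; rewrite /series /= !rmorph_sum mulr_sumr -big_split /=.
  by apply: eq_bigr => i _; exact: complexE.
apply: cvgD; first exact: cvg_real_complex.
by apply: cvgM; [exact: cvg_cst | exact: cvg_real_complex].
Qed.

(** The modulus is a complex number and the order on [R[i]] is partial; writing the modulus of [l]
    as a real [x] makes it comparable with [c], and c < x contradicts the triangle inequality. *)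
Lemma cvg_norm_le (u : nat -> C) (l : C) (c : R) :
  u @ \oo --> l -> (\forall n \near \oo, `|u n| <= c%:C%C) -> `|l| <= c%:C%C.
Proof.
move=> ul uc; have := normc_def l; set x := Num.sqrt _ => lx.
rewrite lx lecR leNgt; apply/negP => cx.
have e_gt0 : 0 < (x - c)%:C%C :> R[i] by rewrite ltcR subr_gt0.
near \oo => n.
have : `|l| < (x - c)%:C%C + c%:C%C.
  rewrite -[l](subrK (u n)); apply: le_lt_trans (ler_normD _ _) _.
  apply: ltr_leD; last by near: n.
  by near: n; move/cvgrPdist_lt: ul; apply.
by rewrite -rmorphD subrK lx ltxx.
Unshelve. all: by end_near. Qed.

End ComplexSeries.

(** * q-binomial identities and closed forms *)

Section QPochIdentities.
Variables (K : fieldType) (x : K).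
Local Notation Q := (qpoch x x).
Hypothesis Q_neq0 : forall n, Q n != 0.

Lemma qpochS n : Q n.+1 = Q n * (1 - x ^+ n.+1).
Proof. by rewrite /qpoch big_nat_recr //= -exprS. Qed.

(** The q-Pascal rule; over a common denominator it is 1 - AB = (1 - A) + A (1 - B), with A =
    x^(a+1) and B = x^(b+1). *)
Lemma qpoch_pascal a b :
  Q (a.+1 + b.+1) / (Q a.+1 * Q b.+1) =
  Q (a + b.+1) / (Q a * Q b.+1) + x ^+ a.+1 * (Q (a.+1 + b) / (Q a.+1 * Q b)).
Proof.
have S0 n : 1 - x ^+ n.+1 != 0.
  by have := Q_neq0 n.+1; rewrite qpochS mulf_eq0 negb_or => /andP[].
have [Sa Sb] := (S0 a, S0 b); have [Qa Qb] := (Q_neq0 a, Q_neq0 b).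
rewrite addSn addnS !qpochS.
have -> : x ^+ (a + b).+2 = x ^+ a.+1 * x ^+ b.+1.
  by rewrite -exprD addSn addnS.
move: Sa Sb; set A := x ^+ a.+1; set B := x ^+ b.+1 => Sa Sb.
by field; rewrite Sa Sb Qa Qb.
Qed.

(* m stands for the column m.+1, a for the arm and b for the leg: partitions
   with parts <= m.+1 + a, exactly b of which are >= m.+1. *)
Definition leg_gf m a b : K := x ^+ (b * m.+1) / Q m * (Q (a + b) / (Q a * Q b)).

Lemma leg_gf_leg0 m a : leg_gf m a 0 = (Q m)^-1.
Proof.
have Q0 : Q 0 = 1 by rewrite /qpoch big_geq.
by rewrite /leg_gf mul0n expr0 addn0 Q0 mulr1 divff ?mulr1 ?div1r.
Qed.

Lemma leg_gf_arm0 m b : leg_gf m 0 b.+1 = x ^+ m.+1 * leg_gf m 0 b.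
Proof.
have Q0 : Q 0 = 1 by rewrite /qpoch big_geq.
rewrite /leg_gf !add0n !Q0 !mul1r !divff // !mulr1 mulrA.
by rewrite -exprD mulSn.
Qed.

Lemma leg_gf_rec m a b :
  leg_gf m a.+1 b.+1 = leg_gf m a b.+1 + x ^+ (m + a.+1).+1 * leg_gf m a.+1 b.
Proof.
rewrite /leg_gf qpoch_pascal mulrDr; congr (_ + _).
have -> : x ^+ (b.+1 * m.+1) = x ^+ m.+1 * x ^+ (b * m.+1).
  by rewrite -exprD mulSn.
rewrite -addSn exprD; ring.
Qed.

(* Hooks of size k.+1 in column m.+1 over partitions with parts <= m + c. *)
Definition hook_gf m k c : K :=
  (\sum_(0 <= a < c | (a <= k)%N) x ^+ (m + a).+1 * Q (m + a) * leg_gf m a (k - a))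
    / Q (m + c).

(** This is [gf_hooks_cons] in the limit, solved for its left side: the new summand a = c has the
    factor [Q (m + c)], which cancels. *)
Lemma hook_gf_rec m k c : hook_gf m k c.+1 =
  (hook_gf m k c + x ^+ (m + c).+1 * if (c <= k)%N then leg_gf m c (k - c) else 0)
    / (1 - x ^+ (m + c).+1).
Proof.
rewrite /hook_gf addnS qpochS invfM mulrA; congr (_ / _).
rewrite big_mkcond [in RHS]big_mkcond big_nat_recr //= mulrDl; congr (_ + _).
case: ifP => _; last by rewrite mul0r mulr0.
by rewrite mulrAC mulfK.
Qed.

(** Arms longer than [k] contribute nothing, so the numerator is constant from c = k + 1 on. *)
Lemma hook_gf_sum m k j :
  hook_gf m k (k.+1 + j) = hook_gf m k k.+1 * Q (m + k.+1) / Q (m + (k.+1 + j)).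
Proof.
rewrite /hook_gf mulfVK //; congr (_ / _).
rewrite (big_cat_nat (n := k.+1)) ?leq_addr //= [X in _ + X]big_nat_cond.
by rewrite [X in _ + X]big1 ?addr0 // => a; lia.
Qed.

Lemma hook_gf_closed m k : x != 0 ->
  hook_gf m k k.+1 * Q (m + k.+1) =
  x ^+ (k.+1 * m.+1) * Q k * \sum_(1 <= l < k.+2)
    x ^- ((l - 1) * m) * qpoch (x ^+ m.+1) x (l - 1) / (Q (l - 1) * Q (k.+1 - l)).
Proof.
move=> x0; rewrite /hook_gf mulfVK // big_add1 /= mulr_sumr.
rewrite big_nat_cond [RHS]big_nat; apply: eq_big => [a|a /andP[_ ak]].
  by case: (a < k.+1)%N / ltnP; rewrite ?andbF //=.
rewrite subn1 subSS /= /leg_gf subnKC // qpochD -exprS.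
(* Here l = a + 1, and [qpochD] has split [Q (m + a)] as [Q m] times the q-Pochhammer symbol of the
   goal; the factor x^(am) cancels the negative power. *)
have -> : x ^+ (k.+1 * m.+1) =
    x ^+ (m + a).+1 * x ^+ ((k - a) * m.+1) * x ^+ (a * m).
  by rewrite -!exprD; congr (_ ^+ _); nia.
have xam : x ^+ (a * m) != 0 by rewrite expf_neq0.
have [Qa Qm Qka] := And3 (Q_neq0 a) (Q_neq0 m) (Q_neq0 (k - a)).
move: xam; set X := x ^+ (a * m) => xam.
by field; rewrite xam Qa Qm Qka.
Qed.

End QPochIdentities.

(** * Limits at a complex q with 0 < |q| < 1 *)

Section ComplexGF.
Variables (R : realType) (q : R[i]^o) (r : R).
Hypotheses (q_norm : `|q| = r%:C%C) (r_gt0 : 0 < r) (r_lt1 : r < 1).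
Local Notation C := (R[i]^o).

Let r_ge0 : 0 <= r. Proof. exact: ltW. Qed.

Lemma normXq n : `|q ^+ n| = (r ^+ n)%:C%C.
Proof. by rewrite normrX q_norm rmorphXn. Qed.

Lemma subXq_neq0 n : 1 - q ^+ n.+1 != 0.
Proof.
apply/eqP => /subr0_eq /(congr1 Num.norm); rewrite normXq normr1 => /complexI.
by apply/eqP; rewrite eq_sym lt_eqF // exprn_ilt1.
Qed.

Lemma qpoch_neq0 n : qpoch q q n != 0.
Proof.
by rewrite /qpoch prodf_seq_neq0; apply/allP => t _; rewrite -exprS subXq_neq0.
Qed.

(** Factorwise, 1 - r^j <= |1 - q^j| <= 1 + r^j <= 1 / (1 - r^j), the last since (1 + r^j) (1 - r^j)
    <= 1. *)
Lemma norm_qpoch_bounds n :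
  (qpoch r r n)%:C%C <= `|qpoch q q n| <= ((qpoch r r n)^-1)%:C%C.
Proof.
elim: n => [|n /andP[IHl IHr]].
  by rewrite /qpoch !big_geq // invr1 normr1 lexx.
have r1 : 0 < 1 - r ^+ n.+1 by rewrite subr_gt0 exprn_ilt1.
have P_gt0 : 0 < qpoch r r n.
  by apply: prodr_gt0 => t _; rewrite subr_gt0 -exprS exprn_ilt1.
have -> : qpoch r r n.+1 = qpoch r r n * (1 - r ^+ n.+1).
  by rewrite /qpoch big_nat_recr //= -exprS.
rewrite qpochS normrM invfM !rmorphM /=; apply/andP; split.
  apply: ler_pM => //; [by rewrite ler0c ltW | by rewrite ler0c ltW |].
  rewrite rmorphB rmorph1 /= -normXq.
  by have := lerB_dist (1 : C) (q ^+ n.+1); rewrite normr1.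
apply: ler_pM => //; apply: le_trans (ler_normB _ _) _.
rewrite normr1 normXq -(rmorph1 (real_complex R)) -rmorphD lecR.
rewrite -[leRHS]mul1r ler_pdivlMr // mulrC -subr_sqr expr1n.
by rewrite gerBl sqr_ge0.
Qed.

Lemma qpoch_cvg : exists2 P : C, P != 0 & qpoch q q @ \oo --> P.
Proof.
have [d d_gt0 dP] := qpoch_lower_bound r_ge0 r_lt1.
have upper n : `|qpoch q q n| <= (d^-1)%:C%C.
  have /andP[_ /le_trans] := norm_qpoch_bounds n; apply.
  by rewrite lecR lef_pV2 ?posrE // (lt_le_trans d_gt0).
(* [a n] is the difference of consecutive partial products, so their convergence becomes that of a
   series dominated by a geometric one. *)
pose a n := - (qpoch q q n * q ^+ n.+1) : C.
have [|n|l al] := @dominated_complex_series_cvg R a (fun n => d^-1 * r ^+ n)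
    (d^-1 * (1 - r)^-1).
- move=> n; rewrite normrN normrM normXq rmorphM /=.
  apply: ler_pM (upper n) _ => //; first by rewrite ler0c exprn_ge0.
  by rewrite lecR exprS ler_piMl ?exprn_ge0 // ltW.
- rewrite /series /= -mulr_sumr ler_wpM2l ?geom_sum_le //.
  by rewrite invr_ge0 ltW.
have cvgP : qpoch q q @ \oo --> 1 + l.
  have -> : qpoch q q = (fun n => 1 + series a n).
    apply/funext => n; elim: n => [|n IHn].
      by rewrite /series /= /qpoch !big_geq // addr0.
    rewrite qpochS /series /= big_nat_recr //= addrA.
    by rewrite [X in _ = X + _]/= -IHn /a mulrBr mulr1.
  exact: (cvgD (cvg_cst (1 : C)) al).
exists (1 + l) => //; apply/eqP => P0; move: cvgP; rewrite P0.
move=> /cvgrPdist_lt/(_ d%:C%C); rewrite ltcR => /(_ d_gt0)[n _ /(_ n (leqnn n))].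
rewrite /= sub0r normrN => Pn_lt.
have /andP[Pn_ge _] := norm_qpoch_bounds n.
have dPn : d%:C%C <= (qpoch r r n)%:C%C by rewrite lecR.
by have := le_lt_trans (le_trans dPn Pn_ge) Pn_lt; rewrite ltxx.
Qed.

Lemma gf_partial_cvg w N : gf_bounded r w N ->
  exists z : C, gf_partial q w N @ \oo --> z.
Proof.
move=> [B wB]; apply: (@dominated_complex_series_cvg R
  (fun n => (psum w N n)%:R * q ^+ n) (fun n => (psum w N n)%:R * r ^+ n) B) => // n.
by rewrite normrM normXq normr_nat rmorphM rmorph_nat.
Qed.

Lemma cvg_gf_step (u u' v : nat -> C) N (x y : C) :
  (forall M, u M = u' M + q ^+ N.+1 * v (M - N.+1)%N) ->
  u' @ \oo --> x -> v @ \oo --> y -> u @ \oo --> x + q ^+ N.+1 * y.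
Proof.
move=> uE ux vy.
have vy' : (fun M => v (M - N.+1)%N) @ \oo --> y by rewrite cvg_centern.
rewrite (_ : u = fun M => u' M + q ^+ N.+1 * v (M - N.+1)%N); last exact/funext.
exact: (cvgD ux (cvgM (cvg_cst (q ^+ N.+1)) vy')).
Qed.

(** The sequence occurs on both sides of its recurrence, so boundedness at [r] first supplies a
    limit z; then z = x + q^(N+1) (z + y) determines it. *)
Lemma cvg_gf_geom_step w N (v : nat -> C) (x y : C) : gf_bounded r w N.+1 ->
  (forall M, gf_partial q w N.+1 M = gf_partial q w N M +
    q ^+ N.+1 * (gf_partial q w N.+1 (M - N.+1) + v (M - N.+1)%N)) ->
  gf_partial q w N @ \oo --> x -> v @ \oo --> y ->
  gf_partial q w N.+1 @ \oo --> (x + q ^+ N.+1 * y) / (1 - q ^+ N.+1).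
Proof.
move=> /gf_partial_cvg[z wz] wE wx vy.
have wz' := cvg_gf_step wE wx (cvgD wz vy).
have zE : z = x + q ^+ N.+1 * (z + y).
  exact: (cvg_unique (@norm_hausdorff _ C) wz (wz' _)).
suff -> : (x + q ^+ N.+1 * y) / (1 - q ^+ N.+1) = z by [].
apply: (canLR (mulfK (subXq_neq0 N))).
by rewrite mulrBr mulr1 {1}zE mulrDr addrA addrAC [z * _]mulrC addrK.
Qed.

End ComplexGF.

(** * Generating functions of legs and hooks for bounded parts *)

Section LegHookGF.
Variables (R : realType) (q : R[i]^o) (r : R).
Hypotheses (q_norm : `|q| = r%:C%C) (r_gt0 : 0 < r) (r_lt1 : r < 1).
Local Notation C := (R[i]^o).
Local Notation Q := (qpoch q q).

Let r_ge0 : 0 <= r. Proof. exact: ltW. Qed.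
Let Q_neq0 n : Q n != 0 := qpoch_neq0 q_norm r_gt0 r_lt1 n.

Lemma cvg_gf_leg0_small m N : (N < m)%N ->
  gf_partial q (leg_weight m 0) N @ \oo --> (Q N)^-1.
Proof.
elim: N => [|N IHN] Nm.
  (* The partial sum is empty at M = 0 and equals 1 afterwards, hence the shift. *)
  rewrite -cvg_shiftS [X in X @ \oo](_ : _ = cst 1).
    by rewrite /qpoch big_geq // invr1; exact: cvg_cst.
  by apply/funext => M /=; rewrite gf_partial0 mulr1.
have zero_cvg : (fun=> 0 : C) @ \oo --> (0 : C) by exact: cvg_cst.
have := cvg_gf_geom_step q_norm r_gt0 r_lt1
  (gf_bounded_leg r_ge0 r_lt1 m 0 N.+1) _ (IHN (ltnW Nm)) zero_cvg.
rewrite mulr0 addr0 qpochS invfM; apply => M.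
by rewrite addr0 gf_leg0_small.
Qed.

Lemma cvg_gf_legS_small m b N : (N < m)%N ->
  gf_partial q (leg_weight m b.+1) N @ \oo --> (0 : C).
Proof.
move=> Nm; rewrite [X in X @ \oo](_ : _ = cst 0); first exact: cvg_cst.
by apply/funext => M; rewrite gf_legS_small.
Qed.

Lemma cvg_gf_leg m a b :
  gf_partial q (leg_weight m.+1 b) (m + a).+1 @ \oo --> (leg_gf q m a b : C).
Proof.
elim: b a => [|b IHb] a.
  rewrite (leg_gf_leg0 Q_neq0); elim: a => [|a IHa]; rewrite ?addn0 ?addnS.
    have -> : gf_partial q (leg_weight m.+1 0) m.+1 =
        gf_partial q (leg_weight m.+1 0) m.
      by apply/funext => M; rewrite gf_leg0_large.
    exact: cvg_gf_leg0_small.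
  have -> : gf_partial q (leg_weight m.+1 0) (m + a).+2 =
      gf_partial q (leg_weight m.+1 0) (m + a).+1.
    by apply/funext => M; rewrite gf_leg0_large //; lia.
  exact: IHa.
elim: a => [|a IHa].
  rewrite (leg_gf_arm0 Q_neq0) -[X in _ --> X]add0r -[in q ^+ m.+1](addn0 m).
  apply: (cvg_gf_step (N := (m + 0)%N)) _ (IHb 0%N) => [M|].
    by rewrite gf_legS_large // addn0.
  by apply: cvg_gf_legS_small; rewrite addn0.
rewrite (leg_gf_rec Q_neq0).
apply: (cvg_gf_step (N := (m + a.+1)%N)) _ (IHb a.+1).
  by move=> M; rewrite gf_legS_large //; lia.
by rewrite addnS.
Qed.

Lemma cvg_gf_hooks m k c :
  gf_partial q (nb_col_hooks m.+1 k.+1) (m + c) @ \oo --> (hook_gf q m k c : C).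
Proof.
have step N (x : C) (l : C) :
    gf_partial q (nb_col_hooks m.+1 k.+1) N @ \oo --> x ->
    (fun M => if (m.+1 <= N.+1)%N && (N.+1 - m.+1 <= k)%N
      then gf_partial q (leg_weight m.+1 (k - (N.+1 - m.+1))) N.+1 M else 0)
      @ \oo --> l ->
    gf_partial q (nb_col_hooks m.+1 k.+1) N.+1 @ \oo -->
      (x + q ^+ N.+1 * l) / (1 - q ^+ N.+1).
  apply: (cvg_gf_geom_step q_norm r_gt0 r_lt1); first exact: gf_bounded_hooks.
  by move=> M; exact: gf_hooks_cons.
have zero_cvg : (fun=> 0 : C) @ \oo --> (0 : C) by exact: cvg_cst.
have small N : (N <= m)%N ->
    gf_partial q (nb_col_hooks m.+1 k.+1) N @ \oo --> (0 : C).
  elim: N => [|N IHN] Nm.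
    have -> : gf_partial q (nb_col_hooks m.+1 k.+1) 0 = (fun=> 0).
      by apply/funext => M; rewrite gf_partial0 mulr0.
    exact: zero_cvg.
  have := step N 0 0 (IHN (ltnW Nm)); rewrite ltnS leqNgt Nm /= mulr0 addr0 mul0r.
  by apply; exact: zero_cvg.
elim: c => [|c IHc].
  have -> : hook_gf q m k 0 = 0 by rewrite /hook_gf big_geq // mul0r.
  by rewrite addn0; exact: small.
rewrite (hook_gf_rec Q_neq0) addnS; apply: (step _ _ _ IHc).
rewrite !subSS addKn leq_addr /=; case: (c <= k)%N; last exact: zero_cvg.
exact: cvg_gf_leg.
Qed.

End LegHookGF.

(** * Letting the bound on the parts tend to infinity *)

Section UnboundedParts.
Variables (R : realType) (q : R[i]^o) (r : R).
Hypotheses (q_norm : `|q| = r%:C%C) (r_gt0 : 0 < r).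
Local Notation C := (R[i]^o).

Definition total (w : seq nat -> nat) (n : nat) : nat :=
  (\sum_(la : intpart n) w la)%N.

Lemma series_total (K : realFieldType) (x : K) w N M : (M <= N)%N ->
  series (fun n => (total w n)%:R * x ^+ n) M = gf_partial x w N M.
Proof.
move=> MN; apply: eq_big_nat => n /andP[_ nM].
by rewrite psum_all // (leq_trans (ltnW nM)).
Qed.

(* Partitions of n <= N have no part larger than N, so restricting the parts
   only affects the coefficients beyond N. *)
Lemma norm_total_sub_gf_partial w N M : (N <= M)%N ->
  `|series (fun n => (total w n)%:R * q ^+ n) M - gf_partial q w N M| <=
    (series (fun n => (total w n)%:R * r ^+ n) M -
     series (fun n => (total w n)%:R * r ^+ n) N)%:C%C.
Proof.
move=> NM; rewrite sub_series_geq //.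
have -> : series (fun n => (total w n)%:R * q ^+ n) M - gf_partial q w N M =
    \sum_(N <= n < M) (total w n - psum w N n)%:R * q ^+ n.
  rewrite /series /gf_partial /= -sumrB (big_cat_nat (n := N)) //= big_nat.
  rewrite big1 ?add0r => [|n /andP[_ nN]]; last by rewrite psum_all ?subrr // ltnW.
  by apply: eq_bigr => n _; rewrite natrB ?psum_le_sum // mulrBl.
rewrite rmorph_sum; apply: le_trans (ler_norm_sum _ _ _) _.
apply: ler_sum => n _; rewrite normrM (normXq q_norm) normr_nat.
rewrite rmorphM rmorph_nat; apply: ler_pM => //.
  by rewrite ler0c exprn_ge0 // ltW.
by rewrite ler_nat leq_subr.
Qed.

Lemma cvg_series_total w (B : R) (l : nat -> C) (L : C) :
  (forall N M, gf_partial r w N M <= B) ->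
  (forall N, gf_partial q w N @ \oo --> l N) -> l @ \oo --> L ->
  series (fun n => (total w n)%:R * q ^+ n) @ \oo --> L.
Proof.
move=> wB wl lL; pose b n : R := (total w n)%:R * r ^+ n.
have b_ge0 n : 0 <= b n by rewrite mulr_ge0 ?exprn_ge0 // ltW.
have bB n : series b n <= B by rewrite (series_total r w (leqnn n)).
have nd_b : nondecreasing_seq (series b).
  by apply/nondecreasing_seqP => n; rewrite /series /= [leRHS]big_nat_recr //= lerDl.
have cvg_b : cvgn (series b).
  by apply: nondecreasing_is_cvgn => //; exists B => _ [n _ <-]; exact: bB.
have [z zP] : exists z : C, series (fun n => (total w n)%:R * q ^+ n) @ \oo --> z.
  apply: dominated_complex_series_cvg bB => n.
  by rewrite normrM (normXq q_norm) normr_nat rmorphM rmorph_nat.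
(* The tail of the real series bounds the error of restricting the parts, so [l] also tends to [z];
   this exchanges the two limits. *)
have zl N : `|z - l N| <= (limn (series b) - series b N)%:C%C.
  apply: (cvg_norm_le (cvgB zP (wl N))); near=> M.
  apply: le_trans (_ : (series b M - series b N)%:C%C <= _).
    by apply: norm_total_sub_gf_partial; near: M; exact: nbhs_infty_ge.
  by rewrite lecR lerD2r; exact: nondecreasing_cvgn_le.
suff lz : l @ \oo --> z by rewrite (cvg_unique (@norm_hausdorff _ C) lL lz).
apply/cvgrPdist_lt => e; rewrite ltcE => /andP[/eqP e_im e_re]; near=> N.
apply: le_lt_trans (zl N) _; rewrite ltcE /= e_im eqxx /=.
apply: le_lt_trans (ler_norm _) _; near: N.
by move/cvgrPdist_lt: cvg_b; apply.
Unshelve. all: by end_near. Qed.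

End UnboundedParts.

(** * The generating function of column hooks over all partitions *)

Theorem theorem1p5 (R : realType) (m k : nat) (q : R[i]^o) :
  (1 <= m)%N -> (1 <= k)%N -> 0 < `|q| < 1 ->
  series (fun n : nat =>
      (\sum_(la : intpart n) nb_col_hooks m k la)%N%:R * q ^+ n) @ \oo -->
    q ^+ (k * m) / qpoch_inf (q ^+ k) q *
    \sum_(1 <= l < k.+1)
      q ^- ((l - 1) * (m - 1)) * qpoch (q ^+ m) q (l - 1) /
      (qpoch q q (l - 1) * qpoch q q (k - l)).
Proof.
(* From here on the column is [m.+1] and the hook size [k.+1]. *)
case: m k => [|m] [|k] // _ _; have := normc_def q.
move: (Num.sqrt _) => r q_norm; rewrite q_norm ltcR => /andP[r_gt0 qr_lt1].
have r_lt1 : r < 1 by rewrite -ltcR.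
have Q_neq0 := qpoch_neq0 q_norm r_gt0 r_lt1.
have q_neq0 : q != 0.
  apply/eqP => q0; move: q_norm; rewrite q0 normr0 => /esym/complexI r0.
  by rewrite r0 ltxx in r_gt0.
have [P P_neq0 cvgQ] := qpoch_cvg q_norm r_gt0 r_lt1.
have [B wB] := gf_hooks_uniform_bound (ltW r_gt0) r_lt1 m.+1 k.
have small_parts N : exists z : R[i]^o,
    gf_partial q (nb_col_hooks m.+1 k.+1) N @ \oo --> z.
  by apply: (gf_partial_cvg q_norm); exists B.
have [l lP] := choice small_parts.
have PkE : qpoch_inf (q ^+ k.+1) q = P / qpoch q q k.
  apply: (cvg_lim (@norm_hausdorff _ _)).
  have -> : qpoch (q ^+ k.+1) q = (fun n => qpoch q q (n + k) / qpoch q q k).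
    by apply/funext => n; rewrite addnC qpochD -exprS mulrAC divff ?mul1r.
  apply: cvgM; last exact: cvg_cst.
  by rewrite (cvg_shiftn k (qpoch q q)).
rewrite PkE subn1 /=.
have -> : q ^+ (k.+1 * m.+1) / (P / qpoch q q k) *
    \sum_(1 <= l < k.+2) q ^- ((l - 1) * m) * qpoch (q ^+ m.+1) q (l - 1) /
      (qpoch q q (l - 1) * qpoch q q (k.+1 - l)) =
    hook_gf q m k k.+1 * qpoch q q (m + k.+1) / P.
  by rewrite (hook_gf_closed Q_neq0) // invf_div mulrA mulrAC.
apply: (cvg_series_total q_norm r_gt0 wB lP).
(* From this index on, [l] is a constant divided by (q;q)_N, whose limit [P] is nonzero. *)
rewrite -(cvg_shiftn (m + k.+1)).
rewrite [X in X @ \oo](_ : _ = fun j =>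
    hook_gf q m k k.+1 * qpoch q q (m + k.+1) / qpoch q q (j + (m + k.+1))).
  apply: cvgM; first exact: cvg_cst.
  apply: cvgV => //.
  by rewrite (cvg_shiftn (m + k.+1) (qpoch q q)).
apply/funext => j /=.
have -> : (j + (m + k.+1) = m + (k.+1 + j))%N by lia.
rewrite -(hook_gf_sum Q_neq0).
apply: (cvg_unique (@norm_hausdorff _ _) (lP _)).
exact: (cvg_gf_hooks q_norm r_gt0 r_lt1).
Qed.
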